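(* For each integer $n\ge 1$ there exists a Steiner triple system $L$ of order $6n+3$ such that $\mathcal{D}(L,3)=6n+3$. Consequently $\mathcal{D}(6n+3,3)=6n+3$.
   Context: A Steiner triple system of order $v$, $\mathrm{STS}(v)$, is a pair $(V,\mathcal{B})$ where $|V|=v$ and $\mathcal{B}$ is a collection of $3$-subsets of $V$ (blocks) such that every $2$-subset of $V$ lies in exactly one block. A $3$-coloring is a map $\phi:V\to C$ with $|C|=3$ such that no block is monochromatic. A defining set of a $3$-coloring $\phi$ is a subset $S\subseteq V$ together with the colors $\phi|_S$ such that $\phi$ is the unique $3$-coloring of $(V,\mathcal{B})$ extending $\phi|_S$. A defining set is minimal if no proper subset of it (with the restricted colors) is a defining set of the same coloring. For an $\mathrm{STS}(v)$ $D$ admitting a $3$-coloring, $\mathcal{D}(D,3)$ is the largest cardinality of a minimal defining set of a $3$-coloring of $D$ (maximum over all $3$-colorings and all their minimal defining sets), and $\mathcal{D}(v,3)=\max\{\mathcal{D}(D,3)\}$ over all $3$-chromatic Steiner triple systems $D$ of order $v$. *)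

(* Defs.v *)
From mathcomp Require Import all_boot.

Set Implicit Arguments.
Unset Strict Implicit.
Unset Printing Implicit Defensive.

Definition steiner_triple_system (T : finType) (B : {set {set T}}) : bool :=
  [forall b in B, #|b| == 3] &&
  [forall p : {set T}, (#|p| == 2) ==> (#|[set b in B | p \subset b]| == 1)].

(* Colorings need not use all k colors. *)
Definition coloring (T : finType) (B : {set {set T}}) (k : nat)
    (phi : {ffun T -> 'I_k}) : bool :=
  [forall b in B, ~~ [exists c : 'I_k, [forall x in b, phi x == c]]].

Definition colorable (T : finType) (B : {set {set T}}) (k : nat) : bool :=
  [exists phi : {ffun T -> 'I_k}, coloring B phi].

Definition chromatic (T : finType) (B : {set {set T}}) (k : nat) : bool :=
  colorable B k && [forall j : 'I_k, ~~ colorable B j].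

(* The set of colorings extending the restriction of phi to S is {phi}; in
   particular phi is itself a coloring. *)
Definition defining_set (T : finType) (B : {set {set T}}) (k : nat)
    (phi : {ffun T -> 'I_k}) (S : {set T}) : bool :=
  [set psi : {ffun T -> 'I_k} |
     coloring B psi && [forall x in S, psi x == phi x]] == [set phi].

Definition minimal_defining_set (T : finType) (B : {set {set T}}) (k : nat)
    (phi : {ffun T -> 'I_k}) (S : {set T}) : bool :=
  minset (defining_set B phi) S.

(* D(B, k).  A k-colorable B has some minimal defining set, so the maximum is
   over a nonempty family; it is 0 by convention when B is not k-colorable. *)
Definition max_defining (T : finType) (B : {set {set T}}) (k : nat) : nat :=
  \max_(phi : {ffun T -> 'I_k})
    \max_(S : {set T} | minimal_defining_set B phi S) #|S|.

(* D(v, k).  max_defining is invariant under relabelling of the points, so it is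
   enough to consider systems on the point set 'I_v. *)
Definition max_defining_order (v k : nat) : nat :=
  \max_(B : {set {set 'I_v}} | steiner_triple_system B && chromatic B k)
    max_defining B k.

(* Main.v *)
Require Import Defs.
From mathcomp Require Import all_boot.
From mathcomp Require Import ssralg finalg zmodp.
From mathcomp Require Import zify.

(** Let [L] be the Bose system on [Z_(2n+1) * Z_3], whose blocks are the fibres
    [{x} * Z_3] and the triples [(x, i), (y, i), ((x + y) / 2, i + 1)] with
    [x <> y], and colour a point by its second coordinate.  Two points of
    colour [i] always determine a third point of colour [i + 1] and never one
    of colour [i + 2], so changing the colour of any single point from [j] to
    [j + 1] gives again a colouring.  Hence a defining set contains every point.
    Double counting bichromatic pairs shows that a Steiner triple system on at
    least five points has no 2-colouring, so [L] is 3-chromatic. *)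

Set Implicit Arguments.
Unset Strict Implicit.
Unset Printing Implicit Defensive.

(** * Steiner quasigroups and their triple systems *)

Section SteinerQuasigroup.

Variables (T : finType) (t : T -> T -> T).

(** Idempotent totally symmetric quasigroups: for [x != y], [t x y] is the third point of the block
    through [x] and [y]. *)
Definition steiner_op :=
  [/\ forall x, t x x = x, forall x y, t x y = t y x
    & forall x y, t x (t x y) = y].

Definition op_triples : {set {set T}} :=
  [set [set p.1; p.2; t p.1 p.2] | p : T * T & p.1 != p.2].

Hypothesis tS : steiner_op.

Let txx x : t x x = x. Proof. by case: tS. Qed.
Let tC x y : t x y = t y x. Proof. by case: tS. Qed.
Let tK x y : t x (t x y) = y. Proof. by case: tS. Qed.
Let tK' x y : t y (t x y) = x. Proof. by rewrite (tC x) tK. Qed.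

Lemma steiner_op_neql x y : x != y -> x != t x y.
Proof. by apply: contraNneq => e; rewrite -(tK x y) -e txx. Qed.

Lemma steiner_op_neqr x y : x != y -> y != t x y.
Proof. by rewrite eq_sym tC => /steiner_op_neql. Qed.

Lemma mem_op_triples x y : x != y -> [set x; y; t x y] \in op_triples.
Proof. by move=> xy; apply/imsetP; exists (x, y); rewrite ?inE. Qed.

(** The laws make each triple closed under [t], so any two of its points generate the third. *)
Lemma op_triples_uniq x y a b :
    a \in [set x; y; t x y] -> b \in [set x; y; t x y] -> a != b ->
  [set x; y; t x y] = [set a; b; t a b].
Proof.
rewrite !inE -!orbA.
move=> /or3P[]/eqP-> /or3P[]/eqP->; rewrite ?eqxx // => _;
  apply/setP => z; rewrite !inE ?tK ?tK' ?(tC (t x y)) ?tK ?tK' ?(tC y x);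
  by case: (z == x); case: (z == y); case: (z == t x y).
Qed.

Lemma op_triples_steiner : steiner_triple_system op_triples.
Proof.
apply/andP; split.
  apply/forall_inP => _ /imsetP[[x y] xy ->]; rewrite inE /= in xy *.
  rewrite -setUA cardsU1 cards2 !inE negb_or xy.
  by rewrite steiner_op_neql // steiner_op_neqr.
apply/forallP => p; apply/implyP => /cards2P[a [b [ab ->]]].
apply/cards1P; exists [set a; b; t a b]; apply/setP => B; rewrite !inE.
apply/andP/eqP => [[/imsetP[[x y] _ ->] /=]|->].
  rewrite subUset !sub1set => /andP[]; move=> ax bx.
  exact: op_triples_uniq.
by rewrite mem_op_triples // subsetUl.
Qed.

Lemma coloring_op_triplesP k (phi : {ffun T -> 'I_k}) :
  reflect (forall x y, x != y -> phi x = phi y -> phi (t x y) <> phi x)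
          (coloring op_triples phi).
Proof.
apply: (iffP forall_inP) => [col x y xy exy et | col _ /imsetP[[x y] xy ->]].
  have /negP[] := col _ (mem_op_triples xy).
  apply/existsP; exists (phi x); apply/forall_inP => z.
  by rewrite !inE -orbA => /or3P[]/eqP->; apply/eqP.
rewrite inE /= in xy *; apply/negP => /existsP[c /forall_inP mono].
have m z : z \in [set x; y; t x y] -> phi z = c by move/mono/eqP.
by apply: (col x y xy); rewrite !m ?inE ?eqxx ?orbT.
Qed.

(* Besides the diagonal, each monochromatic ordered pair [(x, y)] is recovered
   from the bichromatic pair [{x, t x y}], so [a ^ 2 + b ^ 2 <= a * b + (a + b)]
   when the colour classes have [a] and [b] points. *)
Lemma steiner_op_no_bicoloring (c : T -> bool) :
  4 < #|T| -> exists x y, [/\ x != y, c x = c y & c (t x y) = c x].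
Proof.
move=> T5.
case: (boolP [exists x, exists y, [&& x != y, c x == c y & c (t x y) == c x]]).
  move=> /existsP[x /existsP[y /and3P[xy /eqP cxy /eqP ct]]].
  by exists x, y.
move=> /existsPn col.
pose A := [set x | c x]; pose B := ~: A.
pose D := setX A A :|: setX B B.
pose g (p : T * T) := if c (t p.1 p.2) then (p.1, t p.1 p.2)
                      else (p.2, t p.1 p.2).
have sD : D \subset (g @: setX A B) :|: ((fun x => (x, x)) @: [set: T]).
  apply/subsetP => -[x y]; rewrite !inE /= => Dxy.
  have exy : c x = c y by move: Dxy; case: (c x); case: (c y).
  have [<-|xy] := eqVneq x y; first by rewrite [X in _ || X]imset_f ?orbT ?inE.
  have /existsPn/(_ y) := col x; rewrite xy exy eqxx /= => ct.
  apply/orP; left; apply/imsetP; case cy: (c y) ct => ct.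
    exists (x, t x y); first by rewrite !inE /= exy cy; case: (c _) ct.
    by rewrite /g /= tK cy.
  exists (t x y, x); first by rewrite !inE /= exy cy; case: (c _) ct.
  by rewrite /g /= (tC _ x) tK cy.
have cD : #|D| = #|A| * #|A| + #|B| * #|B|.
  rewrite cardsU !cardsX (_ : _ :&: _ = set0) ?cards0 ?subn0 //.
  by apply/setP => -[x y]; rewrite !inE /=; case: (c x); case: (c y).
have cAB : #|A| + #|B| = #|T| by rewrite cardsC.
have := leq_trans (subset_leq_card sD) (leq_card_setU _ _).
have := leq_imset_card g (setX A B); rewrite cardsX.
have := leq_imset_card (fun x : T => (x, x)) [set: T]; rewrite cardsT cD.
move: cAB T5 (#|_ @: setX A B|) (#|_ @: [set: T]|) => <-.
move: #|A| #|B| => a b ab i j ij ia h.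
have {i j ij ia}h : a * a + b * b <= a * b + (a + b) by lia.
wlog le_ab : a b ab h / a <= b => [IH|].
  by have [/IH|/ltnW/IH] := leqP a b; apply; lia.
have [d eb] : exists d, b = a + d by exists (b - a); lia.
subst b; have {h le_ab} : a * a + a * d + d * d <= a + a + d by nia.
(* All solutions have [2 * a + d <= 4]; the extreme one is [a = 2], [d = 0], which is why five
   points are required. *)
by case: a ab => [|[|a]] ab h; nia.
Qed.

Lemma op_triples_not_colorable k :
  4 < #|T| -> k < 3 -> ~~ colorable op_triples k.
Proof.
move=> T5 k3; apply/negP => /existsP[phi /coloring_op_triplesP col].
(* With at most two colours, being 0 or not determines the colour; this treats all [k < 3] at
   once. *)
have inj x y : (phi x == 0 :> nat) = (phi y == 0 :> nat) -> phi x = phi y.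
  case: (phi x) (phi y) => [i ik] [j jk] /= e; apply/val_inj => /=.
  by case: i j ik jk e => [|[|i]] [|[|j]] //=; lia.
have [x [y [xy cxy ct]]] :=
  steiner_op_no_bicoloring (fun x => phi x == 0 :> nat) T5.
exact: (col x y xy (inj _ _ cxy) (inj _ _ ct)).
Qed.

End SteinerQuasigroup.

(** * Colourings whose only defining set is the whole point set *)

Lemma max_defining_le (T : finType) (B : {set {set T}}) k :
  max_defining B k <= #|T|.
Proof.
by apply/bigmax_leqP => phi _; apply/bigmax_leqP => S _; apply: max_card.
Qed.

(** If [x] is outside [S], the recolouring at [x] is a second extension of [phi] from [S]; so only
    [setT] is defining, and it is minimal. *)
Lemma max_defining_full (T : finType) (B : {set {set T}}) k
    (phi : {ffun T -> 'I_k}) :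
    coloring B phi ->
    (forall x, exists psi : {ffun T -> 'I_k},
       [/\ coloring B psi, psi x != phi x & forall y, y != x -> psi y = phi y]) ->
  max_defining B k = #|T|.
Proof.
move=> col recol; apply/eqP; rewrite eqn_leq max_defining_le /=.
suff min : minimal_defining_set B phi setT.
  rewrite -cardsT; apply: leq_trans (leq_bigmax phi).
  exact: (@leq_bigmax_cond _ _ (fun S : {set T} => #|S|) _ min).
apply/minsetP; split.
  apply/eqP/setP => psi; rewrite !inE; apply/andP/eqP => [[_ /forall_inP e]|->].
    by apply/ffunP => x; apply/eqP/e; rewrite inE.
  by split=> //; apply/forall_inP => x _.
move=> S /eqP defS _; apply/setP => x; rewrite inE; apply/negPn/negP => xS.
have [psi [cpsi /negP neq eq]] := recol x.
have : psi \in [set phi].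
  rewrite -defS inE cpsi; apply/forall_inP => y yS; apply/eqP/eq.
  by apply: contraNneq xS => <-.
by rewrite inE => /eqP e; apply: neq; rewrite e.
Qed.

Import GRing.Theory.

(** * Recolouring a single point *)

Section CyclicColoring.

Local Open Scope ring_scope.

Variables (T : finType) (t : T -> T -> T) (phi : {ffun T -> 'I_3}).

(** Every block is rainbow or coloured [i], [i], [i + 1], with addition modulo 3. *)
Definition cyclic_coloring :=
  forall x y, x != y -> phi x = phi y -> phi (t x y) = phi x + 1.

Hypothesis (tS : steiner_op t) (phiS : cyclic_coloring).

Let I3_neq (i : 'I_3) : (i + 1 != i) /\ (i + 1 + 1 != i).
Proof. by case: i => [[|[|[|]]]]. Qed.

Lemma cyclic_coloring_op_triples : coloring (op_triples t) phi.
Proof.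
apply/coloring_op_triplesP => // x y xy exy; rewrite phiS //.
by apply/eqP; case: (I3_neq (phi x)).
Qed.

Lemma cyclic_coloring_recolor x : exists psi : {ffun T -> 'I_3},
  [/\ coloring (op_triples t) psi, psi x != phi x
    & forall y, y != x -> psi y = phi y].
Proof.
have [_ tC tK] := tS.
exists [ffun y => if y == x then phi x + 1 else phi y]; split.
- apply/coloring_op_triplesP => // y z yz; rewrite !ffunE.
  (* In a monochromatic block through [x] the two other points would have
     colour [phi x + 1], so that [phi x = phi x + 1 + 1]. *)
  have bad u v : u != v -> t u v = x -> phi u = phi x + 1 -> phi v = phi x + 1 ->
      False.
    move=> uv tuv eu ev; have := phiS uv; rewrite eu ev tuv => /(_ erefl) e.
    by case: (I3_neq (phi x)) => _; rewrite -e eqxx.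
  have := steiner_op_neql tS yz; have := steiner_op_neqr tS yz.
  have [yx|_] := eqVneq y x; [subst y|have [zx|_] := eqVneq z x; [subst z|]].
  + rewrite (eq_sym z x) (negPf yz) (eq_sym (t _ _)) => zt /negPf-> e1 e2.
    by apply: (bad z (t x z)) => //; rewrite (tC x) tK.
  + rewrite (eq_sym (t _ _)) => /negPf-> yt e1 e2.
    by apply: (bad y (t y x)); rewrite ?tK ?e2.
  + have [tx _ _ e1 e2|_ _ _ e] := eqVneq (t y z) x.
      by apply: (bad y z) => //; rewrite -?e1 e2.
    by rewrite (phiS yz e); apply/eqP; case: (I3_neq (phi y)).
- by rewrite ffunE eqxx; case: (I3_neq (phi x)).
- by move=> y /negPf yx; rewrite ffunE yx.
Qed.

End CyclicColoring.

(** * The Bose construction over a group of odd exponent *)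

Section Bose.

Local Open Scope ring_scope.

Variables (n : nat) (G : finZmodType).
Hypothesis G_exp : forall x : G, x *+ n.*2.+1 = 0.

(** Multiplication by [n + 1] inverts doubling, as [2 * (n + 1)] is 1 modulo [2 * n + 1]. *)
Definition halve (x : G) := x *+ n.+1.

Lemma halve_double x : halve (x + x) = x.
Proof.
by rewrite /halve -mulr2n -mulrnA mul2n doubleS mulrSr G_exp add0r.
Qed.

Lemma double_halve x : halve x + halve x = x.
Proof. by rewrite -mulrnDl; apply: halve_double. Qed.

Lemma double_inj (x y : G) : x + x = y + y -> x = y.
Proof. by move=> e; rewrite -(halve_double x) e halve_double. Qed.

(* The level [- (i + j)] is the one distinct from [i] and [j] when [i != j]. *)
Definition bose_op (p q : G * 'I_3) : G * 'I_3 :=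
  let: (x, i) := p in let: (y, j) := q in
  if i == j then if x == y then (x, i) else (halve (x + y), i + 1)
  else if x == y then (x, - (i + j))
  else if j == i + 1 then (y + y - x, i) else (x + x - y, j).

Lemma bose_op_steiner : steiner_op bose_op.
Proof.
have I3_cyc (i j : 'I_3) : i != j -> (i == j + 1) = (j != i + 1).
  by case: i j => [[|[|[|]]]] // ? [[|[|[|]]]].
have I3_neq (i : 'I_3) : (i == i + 1) = false by case: i => [[|[|[|]]]].
have I3_third (i j : 'I_3) : i != j -> (i == - (i + j)) = false.
  by case: i j => [[|[|[|]]]] // ? [[|[|[|]]]].
split.
- by move=> [x i] /=; rewrite !eqxx.
- move=> [x i] [y j] /=; rewrite (eq_sym j i) (eq_sym y x) (addrC y x) (addrC j i).
  have [->|ij] := eqVneq i j; first by have [->|] := eqVneq x y.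
  have [->|xy] := eqVneq x y => //.
  by rewrite (I3_cyc i j ij); case: (j == i + 1).
- move=> [x i] [y j] /=.
  have [<-|ij] := eqVneq i j.
    have [<-|xy] := eqVneq x y; first by rewrite !eqxx.
    rewrite I3_neq eqxx.
    case: eqVneq => [e|_]; last by rewrite double_halve addrC addKr.
    case/eqP: xy; have := double_halve (x + y); rewrite -e.
    exact: addrI.
  have [<-|xy] := eqVneq x y.
    by rewrite (I3_third i j ij) eqxx opprD opprK addKr.
  (* If [j = i + 1], then [y] is the midpoint, and the third point is the reflection of [x] in [y],
     on level [i]. *)
  have [->|ji] := eqVneq j (i + 1).
    rewrite eqxx; case: eqVneq => [e|_].
      by case/eqP: xy; apply: double_inj; rewrite {1}e subrK.
    by rewrite addrC subrK halve_double.
  (* Now [i = j + 1], so [x] is the midpoint, and reflecting [y] in [x] twice gives back [y]. *)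
  rewrite (negPf ij) (negPf ji); case: eqVneq => [e|_].
    by case/eqP: xy; apply: (@addrI _ x); rewrite {3}e subrK.
  by rewrite opprB addrC subrK.
Qed.

Lemma bose_op_cyclic : cyclic_coloring bose_op [ffun p => p.2].
Proof.
move=> [x i] [y j] neq; rewrite !ffunE /= => e; rewrite -e eqxx.
by have [xy|//] := eqVneq x y; rewrite xy e eqxx in neq.
Qed.

End Bose.

(** * Transport to the points ['I_(6 * n + 3)], and conclusion *)

Lemma steiner_op_transport (T U : finType) (t : T -> T -> T)
    (phi : {ffun T -> 'I_3}) :
    #|T| = #|U| -> steiner_op t -> cyclic_coloring t phi ->
  exists (s : U -> U -> U) (psi : {ffun U -> 'I_3}),
    steiner_op s /\ cyclic_coloring s psi.
Proof.
move=> cTU [txx tC tK] phiS.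
pose f x : U := enum_val (cast_ord cTU (enum_rank x)).
pose g y : T := enum_val (cast_ord (esym cTU) (enum_rank y)).
have fK : cancel f g by move=> x; rewrite /f /g enum_valK cast_ordK enum_rankK.
have gK : cancel g f by move=> y; rewrite /f /g enum_valK cast_ordKV enum_rankK.
exists (fun x y => f (t (g x) (g y))), [ffun x => phi (g x)]; split.
  by split=> [x|x y|x y]; rewrite ?fK ?txx ?gK ?tK ?gK // tC.
move=> x y xy; rewrite !ffunE fK; apply: phiS.
by rewrite (can_eq gK).
Qed.

Theorem theorem3p3 (n : nat) (hn : 1 <= n) :
  (exists L : {set {set 'I_(6 * n + 3)}},
     [/\ steiner_triple_system L, colorable L 3
       & max_defining L 3 = 6 * n + 3]) /\
  max_defining_order (6 * n + 3) 3 = 6 * n + 3.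
Proof.
have expG (x : 'I_n.*2.+1) : (x *+ n.*2.+1 = 0)%R.
  by rewrite Zp_mulrn; apply/val_inj; rewrite /= modnMl.
have cT : #|{: 'I_n.*2.+1 * 'I_3}| = #|'I_(6 * n + 3)|.
  by rewrite card_prod !card_ord; lia.
have [t [phi [tS phiS]]] :=
  steiner_op_transport cT (bose_op_steiner expG) (@bose_op_cyclic n _).
pose L := op_triples t.
have STS : steiner_triple_system L := op_triples_steiner tS.
have col := cyclic_coloring_op_triples phiS.
have colL : colorable L 3 by apply/existsP; exists phi.
have DL : max_defining L 3 = 6 * n + 3.
  by rewrite (max_defining_full col (cyclic_coloring_recolor tS phiS)) card_ord.
split; first by exists L.
apply/eqP; rewrite eqn_leq; apply/andP; split.
  by apply/bigmax_leqP => B _; rewrite -[leqRHS]card_ord max_defining_le.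
rewrite -[leqLHS]DL; apply: (@leq_bigmax_cond _ _ (fun B => max_defining B 3)).
rewrite STS /chromatic colL; apply/forallP => j.
(* As [n >= 1], there are at least nine points, more than the four that a 2-colouring could
   allow. *)
by apply: op_triples_not_colorable; rewrite ?card_ord ?ltn_ord //; lia.
Qed.
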